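(* The following filling-shape-Wilf-equivalences of consecutive patterns hold: $$1342\equiv_{\mathrm{fs}}1432,\qquad 2341\equiv_{\mathrm{fs}}2431,\qquad 4213\equiv_{\mathrm{fs}}4123,\qquad 3214\equiv_{\mathrm{fs}}3124.$$
   Context: Two sequences of positive integers of the same length are order-isomorphic, $a_1\cdots a_k\sim b_1\cdots b_k$, if for all $p,q$ one has $a_p<a_q$ iff $b_p<b_q$. A consecutive pattern is a permutation $\sigma_1\cdots\sigma_k$ of $\{1,\dots,k\}$, whose occurrences are required to be in adjacent positions, as follows. Young diagrams are drawn in French notation: a Young diagram $D$ with $n$ columns and $m$ rows is a set of cells (column, row) in $\{1,\dots,n\}\times\{1,\dots,m\}$ such that if $(a,b)\in D$ then $(a',b')\in D$ for all $1\le a'\le a$, $1\le b'\le b$; the cell $(1,1)$ is at the bottom left. A filling of $D$ is a set of selected cells of $D$ with no two in the same column and no two in the same row. For a column $c$ containing a selected cell, let $\pi(c)$ be the row of that cell. A filling contains the consecutive pattern $\sigma_1\cdots\sigma_k$ if there are consecutive columns $i_1<\cdots<i_k$ (that is, $i_{p+1}-i_p=1$ for $1\le p\le k-1$) such that $(i_1,\pi(i_1)),\dots,(i_k,\pi(i_k))$ are selected cells, $\pi(i_1)\cdots\pi(i_k)\sim\sigma_1\cdots\sigma_k$, and $(i_p,\pi(i_q))\in D$ for all $1\le p,q\le k$. Otherwise it avoids the pattern. Two patterns $\sigma,\tau$ are filling-shape-Wilf-equivalent, $\sigma\equiv_{\mathrm{fs}}\tau$, if for every Young diagram $D$, every set $R$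 of rows and every set $C$ of columns, the number of fillings of $D$ avoiding $\sigma$ whose set of rows without a selected cell is exactly $R$ and whose set of columns without a selected cell is exactly $C$ equals the number of such fillings avoiding $\tau$. *)

(* Defs.v *)
From mathcomp Require Import all_boot.

Set Implicit Arguments.
Unset Strict Implicit.
Unset Printing Implicit Defensive.

Definition order_iso (a b : seq nat) : bool :=
  (size a == size b) &&
  [forall p : 'I_(size a), forall q : 'I_(size a),
     (nth 0 a p < nth 0 a q) == (nth 0 b p < nth 0 b q)].

(* Cells are pairs (column, row), in French notation.  Columns and rows are
   numbered from 0, so the bottom left cell is (0, 0). *)
Notation cells n m := {set 'I_n * 'I_m}.

Definition young_diagram (n m : nat) (D : cells n m) : Prop :=
  forall (a a' : 'I_n) (b b' : 'I_m),
    (a, b) \in D -> a' <= a -> b' <= b -> (a', b') \in D.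

Definition filling (n m : nat) (D F : cells n m) : bool :=
  (F \subset D) &&
  [forall x in F, forall y in F,
     (x.1 == y.1) || (x.2 == y.2) ==> (x == y)].

(* A pattern is a permutation of 1, ..., k in one-line notation.  For a filling
   F, the condition (i_p, r_p) \in F says that r_p is the row pi(i_p). *)
Definition contains (n m : nat) (D F : cells n m) (s : seq nat) : bool :=
  [exists i : (size s).-tuple 'I_n, exists r : (size s).-tuple 'I_m,
    [&& sorted (fun c c' : 'I_n => c' == c.+1 :> nat) i,
        [forall p, (tnth i p, tnth r p) \in F],
        order_iso [seq val b | b <- r] s
      & [forall p, forall q, (tnth i p, tnth r q) \in D]]].

Definition empty_rows (n m : nat) (F : cells n m) : {set 'I_m} :=
  [set b | [forall a, (a, b) \notin F]].

Definition empty_columns (n m : nat) (F : cells n m) : {set 'I_n} :=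
  [set a | [forall b, (a, b) \notin F]].

Definition avoiding_fillings (n m : nat) (D : cells n m) (R : {set 'I_m})
    (C : {set 'I_n}) (s : seq nat) : {set cells n m} :=
  [set F | [&& filling D F, ~~ contains D F s,
               empty_rows F == R & empty_columns F == C]].

Definition fs_equiv (s t : seq nat) : Prop :=
  forall (n m : nat) (D : cells n m) (R : {set 'I_m}) (C : {set 'I_n}),
    young_diagram D ->
    #|avoiding_fillings D R C s| = #|avoiding_fillings D R C t|.

(* Main.v *)
Require Import Defs.
From mathcomp Require Import all_boot.
From mathcomp Require Import zify.

(** The patterns are [abcd] and [acbd], where the two middle letters are
    swapped.  Since [a < b] and [c < d] are not equivalent (and likewise for
    [acbd]), two occurrences cannot share two columns; nor can they share three,
    as then [a < b], [b < c] and [c < d] would all be equivalent.  So no middle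
    column of an occurrence lies in another one.  Hence,
    for a set [S] of columns, exchanging the two middle columns of the
    occurrences starting in [S] is a bijection from the fillings with an
    occurrence of [abcd] at every element of [S] to those with an occurrence of
    [acbd] at every element of [S].  By inclusion-exclusion over [S], as many
    fillings have no occurrence of [abcd] as have no occurrence of [acbd]. *)

Set Implicit Arguments.
Unset Strict Implicit.
Unset Printing Implicit Defensive.

(** Inclusion-exclusion without signs, by induction on the size of the complement of [S]. The
    superset count at [S] is the fiber at [S] plus the fibers at proper supersets; the latter agree
    by induction and cancel. *)
Lemma card_fiber_superset (T I : finType) (A : {set T}) (f g : T -> {set I}) :
    (forall S : {set I},
       #|[set x in A | S \subset f x]| = #|[set x in A | S \subset g x]|) ->
  forall S, #|[set x in A | f x == S]| = #|[set x in A | g x == S]|.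
Proof.
move=> eq_sup S; have [k] := ubnP #|~: S|.
elim: k S => // k IHk S; rewrite ltnS => leSk.
have split_sup (h : T -> {set I}) : #|[set x in A | S \subset h x]| =
    #|[set x in A | h x == S]|
      + \sum_(U : {set I} | S \proper U) #|[set x in A | h x == U]|.
  rewrite -sum1dep_card (partition_big h (fun U => S \subset U)) /=; last first.
    by move=> x /andP[].
  rewrite (bigD1 S) //=; congr (_ + _).
    rewrite -sum1dep_card; apply: eq_bigl => x.
    by case: eqP => [->|]; rewrite ?subxx ?andbT ?andbF.
  apply: eq_big => [U | U /andP[sSU _]]; first by rewrite properEneq eq_sym andbC.
  rewrite -sum1dep_card; apply: eq_bigl => x.
  by case: eqP => [->|]; rewrite ?sSU ?andbT ?andbF.
have := eq_sup S; rewrite !split_sup.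
rewrite (eq_bigr (fun U => #|[set x in A | g x == U]|)) => [/addIn //|U ltSU].
apply: IHk; apply: leq_trans leSk.
by apply: proper_card; rewrite properC.
Qed.

Lemma order_isoP (a b : seq nat) :
  reflect (size a = size b /\ forall p q, p < size a -> q < size a ->
             (nth 0 a p < nth 0 a q) = (nth 0 b p < nth 0 b q))
          (order_iso a b).
Proof.
apply: (iffP andP) => [[/eqP eq_sz /forallP iso]|[-> iso]]; split=> //.
  move=> p q ltp ltq.
  have /forallP/(_ (Ordinal ltq))/eqP := iso (Ordinal ltp).
  exact.
by apply/forallP=> p; apply/forallP=> q; apply/eqP/iso.
Qed.

Lemma order_iso_swap (r0 r1 r2 r3 a b c d : nat) :
  order_iso [:: r0; r1; r2; r3] [:: a; b; c; d] ->
  order_iso [:: r0; r2; r1; r3] [:: a; c; b; d].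
Proof.
move=> /order_isoP[_ iso]; apply/order_isoP; split=> // p q.
(* Each pair of positions is sent to the pair with 1 and 2 exchanged. *)
by move: p q => [|[|[|[|//]]]] [|[|[|[|//]]]] _ _;
   [apply: (iso 0 0)|apply: (iso 0 2)|apply: (iso 0 1)|apply: (iso 0 3)
   |apply: (iso 2 0)|apply: (iso 2 2)|apply: (iso 2 1)|apply: (iso 2 3)
   |apply: (iso 1 0)|apply: (iso 1 2)|apply: (iso 1 1)|apply: (iso 1 3)
   |apply: (iso 3 0)|apply: (iso 3 2)|apply: (iso 3 1)|apply: (iso 3 3)].
Qed.

(** * Occurrences located by their first column, and their spacing *)

Section Occurrences.

Variables (n m : nat) (D : cells n m).
Implicit Types (F : cells n m) (S : {set 'I_n}).

Definition occurs_at F (s : seq nat) (c : 'I_n) : bool :=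
  [exists i : (size s).-tuple 'I_n, exists r : (size s).-tuple 'I_m,
    [&& head c i == c, sorted (fun c c' : 'I_n => c' == c.+1 :> nat) i,
        [forall p, (tnth i p, tnth r p) \in F],
        order_iso [seq val b | b <- r] s
      & [forall p, forall q, (tnth i p, tnth r q) \in D]]].

Definition occurrences F s : {set 'I_n} := [set c | occurs_at F s c].

Lemma containsE F x s :
  contains D F (x :: s) = (occurrences F (x :: s) != set0).
Proof.
apply/existsP/set0Pn => [[i /existsP[r ir]]|[c]].
  exists (thead i); rewrite inE; apply/existsP; exists i; apply/existsP; exists r.
  by rewrite ir andbT; case/tupleP: i {ir} => c i; rewrite theadE.
rewrite inE => /existsP[i /existsP[r /andP[_ ir]]].
by exists i; apply/existsP; exists r.
Qed.

Variant occurs_at4_spec F (a b c d : nat) (c0 : 'I_n) : Prop :=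
  OccursAt4 (c1 c2 c3 : 'I_n) (r0 r1 r2 r3 : 'I_m) of
    c1 = c0.+1 :> nat & c2 = c0.+2 :> nat & c3 = c0.+3 :> nat
  & (c0, r0) \in F & (c1, r1) \in F & (c2, r2) \in F & (c3, r3) \in F
  & order_iso [:: val r0; val r1; val r2; val r3] [:: a; b; c; d]
  & (forall x y, x \in [:: c0; c1; c2; c3] -> y \in [:: r0; r1; r2; r3] ->
       (x, y) \in D).

Lemma occurs_at4P F a b c d c0 :
  reflect (occurs_at4_spec F a b c d c0) (occurs_at F [:: a; b; c; d] c0).
Proof.
apply: (iffP existsP) => [[i /existsP[r]]|].
  case/tupleP: i => x0 i; case/tupleP: i => x1 i; case/tupleP: i => x2 i.
  case/tupleP: i => x3 i; rewrite (tuple0 i) {i}.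
  case/tupleP: r => r0 r; case/tupleP: r => r1 r; case/tupleP: r => r2 r.
  case/tupleP: r => r3 r; rewrite (tuple0 r) {r} /=.
  case/and5P=> /eqP-> /and4P[/eqP e1 /eqP e2 /eqP e3 _] /forallP inF iso /forallP inD.
  apply: (@OccursAt4 _ _ _ _ _ _ x1 x2 x3 r0 r1 r2 r3) => //; try lia.
  - exact: (inF (@Ordinal 4 0 isT)).
  - exact: (inF (@Ordinal 4 1 isT)).
  - exact: (inF (@Ordinal 4 2 isT)).
  - exact: (inF (@Ordinal 4 3 isT)).
  move=> x y /(tnthP [tuple c0; x1; x2; x3])[p ->].
  move=> /(tnthP [tuple r0; r1; r2; r3])[q ->].
  exact: (forallP (inD p) q).
case=> c1 c2 c3 r0 r1 r2 r3 e1 e2 e3 F0 F1 F2 F3 iso inD.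
exists [tuple c0; c1; c2; c3]; apply/existsP; exists [tuple r0; r1; r2; r3].
apply/and5P; split=> //=.
- by rewrite e1 e2 e3 !eqxx.
- by apply/forallP=> -[[|[|[|[|//]]]] ltp].
by apply/forallP=> p; apply/forallP=> q; apply: inD; apply: mem_tnth.
Qed.

Lemma filling_row_uniq F x y z : filling D F ->
  (x, y) \in F -> (x, z) \in F -> y = z.
Proof.
case/andP=> _ /forall_inP injF xyF /(forall_inP (injF _ xyF)) /=.
by rewrite eqxx /= => /eqP[].
Qed.

Lemma filling_column_uniq F x y z : filling D F ->
  (x, z) \in F -> (y, z) \in F -> x = y.
Proof.
case/andP=> _ /forall_inP injF xzF /(forall_inP (injF _ xzF)) /=.
by rewrite eqxx orbT /= => /eqP[].
Qed.

(** With gaps of at least 3, two occurrences share at most the last column of one and the first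
    column of the other. *)
Definition spaced S :=
  forall i j : 'I_n, i \in S -> j \in S -> i < j -> i.+3 <= j.

Lemma spaced_occurrences F a b c d : filling D F -> (a < b) != (c < d) ->
  spaced (occurrences F [:: a; b; c; d]).
Proof.
move=> fillF nov i j; rewrite !inE.
move=> /occurs_at4P[c1 c2 c3 r0 r1 r2 r3 e1 e2 e3 _ F1 F2 F3 /order_isoP[_ iso] _].
move=> /occurs_at4P[d1 d2 d3 s0 s1 s2 s3 f1 f2 f3 G0 G1 G2 _ /order_isoP[_ iso'] _].
move=> ltij; rewrite leqNgt; apply/negP => ltji; case/negP: nov; apply/eqP.
(* [a < b] is read off the first two columns of the later occurrence, [c < d] off the last two of
   the earlier one. *)
have := iso' 0 1 isT isT; have := iso 2 3 isT isT => /= <- <-.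
have [e|e] : j = i.+1 :> nat \/ j = i.+2 :> nat by lia.
  have ej : j = c1 by apply: val_inj => /=; lia.
  have ed1 : d1 = c2 by apply: val_inj => /=; lia.
  have ed2 : d2 = c3 by apply: val_inj => /=; lia.
  subst j d1 d2.
  (* For a shift by one, the goal compares [r1 < r2] with [r2 < r3]. Both amount to [b < c]: the
     first in the earlier occurrence, the second in the later one. *)
  have := iso 1 2 isT isT; have := iso' 1 2 isT isT => /=.
  rewrite (filling_row_uniq fillF F1 G0) (filling_row_uniq fillF F2 G1).
  by rewrite (filling_row_uniq fillF F3 G2) => -> ->.
have ej : j = c2 by apply: val_inj => /=; lia.
have ed1 : d1 = c3 by apply: val_inj => /=; lia.
subst j d1.
by rewrite (filling_row_uniq fillF F2 G0) (filling_row_uniq fillF F3 G1).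
Qed.

(** * The exchange of middle columns *)

Definition mate S (x y : 'I_n) : bool :=
  [exists i in S, ((x == i.+1 :> nat) && (y == i.+2 :> nat)) ||
                  ((x == i.+2 :> nat) && (y == i.+1 :> nat))].

(** The default fixes every column that is not a middle one. For spaced [S] a column has at most one
    mate, so the choice is forced. *)
Definition swap_middle S (x : 'I_n) : 'I_n := odflt x [pick y | mate S x y].

Definition swap_cells S F : cells n m := [set x | (swap_middle S x.1, x.2) \in F].

Lemma mateP S (x y : 'I_n) :
  reflect (exists2 i, i \in S &
             (x = i.+1 :> nat /\ y = i.+2 :> nat) \/
             (x = i.+2 :> nat /\ y = i.+1 :> nat)) (mate S x y).
Proof.
apply: (iffP exists_inP) => -[i iS e]; exists i => //.
  by case/orP: e => /andP[/eqP ? /eqP ?]; [left|right].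
by case: e => -[-> ->]; rewrite !eqxx ?orbT.
Qed.

Lemma mate_sym S x y : mate S x y = mate S y x.
Proof.
by apply/mateP/mateP => -[i iS e]; exists i => //;
   case: e => -[? ?]; [right|left|right|left].
Qed.

Section Spaced.

Variable S : {set 'I_n}.
Hypothesis spS : spaced S.

Lemma spacedE (i j : 'I_n) : i \in S -> j \in S ->
  [\/ i = j :> nat, i.+3 <= j | j.+3 <= i].
Proof.
move=> iS jS; case: (ltngtP i j) => [lt|lt|e].
- by apply: Or32; apply: spS.
- by apply: Or33; apply: spS.
by apply: Or31.
Qed.

Lemma swap_mate x y : mate S x y -> swap_middle S x = y.
Proof.
move=> xy; rewrite /swap_middle; case: pickP => [z xz|/(_ y)]; last by rewrite xy.
case/mateP: xy => i iS e; case/mateP: xz => j jS f; apply: val_inj => /=.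
by case: (spacedE iS jS); lia.
Qed.

Lemma swap_middleP x : swap_middle S x = x \/ mate S x (swap_middle S x).
Proof. by rewrite /swap_middle; case: pickP => [y|]; [right|left]. Qed.

Lemma swap_middleK : involutive (swap_middle S).
Proof.
move=> x; case: (swap_middleP x) => [e|xy]; first by rewrite !e.
by apply: swap_mate; rewrite mate_sym.
Qed.

Lemma swap_middle_end (i x : 'I_n) : i \in S -> x = i :> nat \/ x = i.+3 :> nat ->
  swap_middle S x = x.
Proof.
move=> iS ex; case: (swap_middleP x) => // /mateP[j jS].
by case: (spacedE iS jS); lia.
Qed.

Lemma swap_cellsK : involutive (swap_cells S).
Proof. by move=> F; apply/setP=> -[x y]; rewrite !inE swap_middleK. Qed.

Variables (F : cells n m) (a b c d : nat).
Hypothesis occS : S \subset occurrences F [:: a; b; c; d].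

(** An occurrence requires the whole grid of its columns and rows to lie in [D], so the exchanged
    cells stay inside the diagram. *)
Lemma swap_middle_moved x y : mate S x y ->
  exists r s, [/\ (x, r) \in F, (y, s) \in F, (y, r) \in D & (x, s) \in D].
Proof.
case/mateP=> i iS e; have := subsetP occS _ iS; rewrite inE.
case/occurs_at4P=> c1 c2 c3 r0 r1 r2 r3 e1 e2 _ _ F1 F2 _ _ inD.
case: e => -[ex ey].
  have <- : c1 = x by apply: val_inj => /=; lia.
  have <- : c2 = y by apply: val_inj => /=; lia.
  by exists r1, r2; split=> //; apply: inD; rewrite !inE eqxx ?orbT.
have <- : c2 = x by apply: val_inj => /=; lia.
have <- : c1 = y by apply: val_inj => /=; lia.
by exists r2, r1; split=> //; apply: inD; rewrite !inE eqxx ?orbT.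
Qed.

Lemma filling_swap : filling D F -> filling D (swap_cells S F).
Proof.
move=> fillF; apply/andP; split.
  apply/subsetP=> -[x y]; rewrite inE /=.
  case: (swap_middleP x) => [->|xx' xF].
    by case/andP: fillF => /subsetP sFD _; apply: sFD.
  have [r [s [_ x'F _ xD]]] := swap_middle_moved xx'.
  by rewrite (filling_row_uniq fillF xF x'F).
apply/forall_inP=> -[x y]; rewrite inE /= => xF.
apply/forall_inP=> -[x' y']; rewrite inE /= => xF'.
apply/implyP=> /orP[/eqP e|/eqP e]; subst.
  by rewrite (filling_row_uniq fillF xF xF').
by rewrite (inv_inj swap_middleK (filling_column_uniq fillF xF xF')).
Qed.

Lemma empty_rows_swap : empty_rows (swap_cells S F) = empty_rows F.
Proof.
apply/setP=> y; rewrite !inE; apply/forallP/forallP=> E x; last by rewrite inE /=.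
by have := E (swap_middle S x); rewrite inE /= swap_middleK.
Qed.

Lemma empty_columns_swap : empty_columns (swap_cells S F) = empty_columns F.
Proof.
apply/setP=> x; rewrite !inE.
have -> : [forall y, (x, y) \notin swap_cells S F] =
          [forall y, (swap_middle S x, y) \notin F].
  by apply: eq_forallb => y; rewrite inE.
(* A moved column and its mate both hold a cell of [F], so neither is empty before or after the
   exchange. *)
case: (swap_middleP x) => [->//|/swap_middle_moved[r [s [xF x'F _ _]]]].
apply/idP/idP=> /forallP E; first by have := E s; rewrite x'F.
by have := E r; rewrite xF.
Qed.

Lemma occurrences_swap : S \subset occurrences (swap_cells S F) [:: a; c; b; d].
Proof.
apply/subsetP=> i iS; have := subsetP occS _ iS; rewrite !inE.
case/occurs_at4P=> c1 c2 c3 r0 r1 r2 r3 e1 e2 e3 F0 F1 F2 F3 iso inD.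
have m12 : mate S c1 c2 by apply/mateP; exists i => //; left.
apply/occurs_at4P; apply: (@OccursAt4 _ _ _ _ _ _ c1 c2 c3 r0 r2 r1 r3) => //.
- by rewrite inE /= (swap_middle_end iS) //; left.
- by rewrite inE /= (swap_mate m12).
- by rewrite inE /= (swap_mate (y := c1)) // mate_sym.
- by rewrite inE /= (swap_middle_end iS) //; right.
- exact: order_iso_swap.
by move=> x y xc yr; apply: inD => //; move: yr; rewrite !inE (orbCA (y == r2)).
Qed.

End Spaced.

(** * Comparing the numbers of fillings *)

Variables (R : {set 'I_m}) (C : {set 'I_n}).

Definition RC_fillings : {set cells n m} :=
  [set F | [&& filling D F, empty_rows F == R & empty_columns F == C]].

(** The exchange is injective and maps the first set into the second. The reverse inequality is the
    same statement with [b] and [c] interchanged. *)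
Lemma leq_card_occurrences a b c d S : (a < b) != (c < d) ->
  #|[set F in RC_fillings | S \subset occurrences F [:: a; b; c; d]]| <=
  #|[set F in RC_fillings | S \subset occurrences F [:: a; c; b; d]]|.
Proof.
move=> nov; set A := [set F in _ | _].
(* A member of [A] is needed to know that [S] is spaced, which makes the exchange an involution. *)
have [->|[F0 F0A]] := set_0Vmem A; first by rewrite cards0.
have spS : spaced S.
  move: F0A; rewrite !inE => /andP[/andP[fillF0 _] occS] i j iS jS.
  by apply: (spaced_occurrences fillF0 nov); apply: (subsetP occS).
rewrite -(card_imset (mem A) (inv_inj (swap_cellsK spS))).
apply/subset_leq_card/subsetP=> _ /imsetP[F FA ->].
move: FA; rewrite !inE => /andP[/and3P[fillF eR eC] occS].
rewrite (filling_swap spS occS fillF) (empty_rows_swap spS).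
by rewrite (empty_columns_swap occS) eR eC (occurrences_swap spS occS).
Qed.

Lemma avoiding_fillingsE x s :
  avoiding_fillings D R C (x :: s) =
  [set F in RC_fillings | occurrences F (x :: s) == set0].
Proof.
apply/setP=> F; rewrite !inE containsE negbK -andbA; congr (_ && _).
by rewrite andbC -andbA.
Qed.

End Occurrences.

Lemma fs_equiv_swap_middle a b c d :
  (a < b) != (c < d) -> (a < c) != (b < d) ->
  fs_equiv [:: a; b; c; d] [:: a; c; b; d].
Proof.
move=> nov nov' n m D R C _; rewrite !avoiding_fillingsE.
(* Avoidance is the fiber over [set0]; each of the two hypotheses gives one inequality between the
   superset counts. *)
apply: card_fiber_superset => S; apply/eqP.
by rewrite eqn_leq !leq_card_occurrences.
Qed.

Theorem corollary3p6 :
  [/\ fs_equiv [:: 1; 3; 4; 2] [:: 1; 4; 3; 2],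
      fs_equiv [:: 2; 3; 4; 1] [:: 2; 4; 3; 1],
      fs_equiv [:: 4; 2; 1; 3] [:: 4; 1; 2; 3]
    & fs_equiv [:: 3; 2; 1; 4] [:: 3; 1; 2; 4]].
Proof. by split; apply: fs_equiv_swap_middle. Qed.
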